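(* Let $G$ be a (possibly uncountable) amenable group and let $A$ be a finite set. Then every strongly irreducible subshift $X \subset A^G$ has the Myhill property, i.e., every pre-injective cellular automaton $\tau \colon X \to X$ is surjective.
   Context: $A^G$ is the set of all maps $x \colon G \to A$ (configurations), with the prodiscrete topology (product of discrete topologies). $G$ acts on $A^G$ by $(gx)(h) = x(g^{-1}h)$. A subshift is a closed $G$-invariant subset of $A^G$. For $\Omega \subset G$, $x|_\Omega$ is the restriction of $x$ to $\Omega$. For subsets $\Omega,\Delta \subset G$, put $\Omega^{+\Delta} = \{g \in G : g\Delta \cap \Omega \neq \varnothing\} = \Omega\Delta^{-1}$. Strong irreducibility: for a finite subset $\Delta \subset G$, a subshift $X \subset A^G$ is $\Delta$-irreducible if for all finite subsets $\Omega_1,\Omega_2 \subset G$ with $\Omega_1^{+\Delta} \cap \Omega_2 = \varnothing$ and all $x_1,x_2 \in X$ there exists $x \in X$ with $x|_{\Omega_1} = x_1|_{\Omega_1}$ and $x|_{\Omega_2} = x_2|_{\Omega_2}$. $X$ is strongly irreducible if it is $\Delta$-irreducible for some finite $\Delta \subset G$. A cellular automaton $\tau \colon X \to X$ is a continuous map commuting with the action of $G$. It is pre-injective if $\tau(x_1) = \tau(x_2)$ implies $x_1 = x_2$ whenever $x_1,x_2 \in X$ coincide outside a finite subset of $G$. $G$ is amenable if there exist a directed set $J$ and a family $(F_j)_{j\in J}$ of nonempty finite subsets of $G$ (a Følner net) such that $\lim_j |F_j^{+E}\setminus F_j|/|F_j| = 0$ for every finite subset $E \subset G$. *)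

(* Defs.v *)
From HB Require Import structures.
From mathcomp Require Import all_boot all_order all_algebra monoid finmap.
From mathcomp Require Import all_classical all_reals topology function_spaces normedtype.

Set Implicit Arguments.
Unset Strict Implicit.
Unset Printing Implicit Defensive.

Import GRing.Theory Num.Theory numFieldNormedType.Exports.

Local Open Scope classical_set_scope.
Local Open Scope ring_scope.

(* A^G with the prodiscrete topology. Spelling it with [prod_topology] matters:
   it must not be confused with the topology of uniform convergence that the
   library puts on arrow types. *)
Notation config G A :=
  (prod_topology (fun _ : Group.sort G => discrete_topology (Finite.sort A))).

Definition shift_config (G : groupType) (A : finType) (g : G) (x : config G A) :
  config G A := fun h => x (g^-1 * h)%g.

Definition subshift (G : groupType) (A : finType) (X : set (config G A)) :=
  closed X /\ forall g x, X x -> X (shift_config g x).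

(* Omega^{+Delta} = {g | g Delta meets Omega} *)
Definition dilation (G : groupType) (Omega Delta : set G) : set G :=
  [set g | [set (g * d)%g | d in Delta] `&` Omega !=set0].

Definition irreducible_wrt (G : groupType) (A : finType) (Delta : set G)
    (X : set (config G A)) :=
  forall Omega1 Omega2 : set G, finite_set Omega1 -> finite_set Omega2 ->
    dilation Omega1 Delta `&` Omega2 = set0 ->
  forall x1 x2, X x1 -> X x2 ->
  exists x, [/\ X x, {in Omega1, x =1 x1} & {in Omega2, x =1 x2}].

Definition strongly_irreducible (G : groupType) (A : finType)
    (X : set (config G A)) :=
  exists Delta : set G, finite_set Delta /\ irreducible_wrt Delta X.

(* A map X -> X is represented by a total map stabilizing X; all the conditions
   below only depend on its restriction to X. *)
Definition cellular_automaton (G : groupType) (A : finType)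
    (X : set (config G A)) (tau : config G A -> config G A) :=
  [/\ set_fun X X tau, {within X, continuous tau} &
      forall g x, X x -> tau (shift_config g x) = shift_config g (tau x)].

Definition pre_injective (G : groupType) (A : finType)
    (X : set (config G A)) (tau : config G A -> config G A) :=
  forall x1 x2, X x1 -> X x2 ->
    (exists Omega : set G, finite_set Omega /\ {in ~` Omega, x1 =1 x2}) ->
    tau x1 = tau x2 -> x1 = x2.

Definition Myhill_property (G : groupType) (A : finType)
    (X : set (config G A)) :=
  forall tau : config G A -> config G A,
    cellular_automaton X tau -> pre_injective X tau -> set_surj X X tau.

Definition directed_set (J : Type) (le : J -> J -> Prop) :=
  [/\ inhabited J, forall i, le i i,
      forall i j k, le i j -> le j k -> le i k &
      forall i j, exists k, le i k /\ le j k].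

(* Convergence of a net along a directed set is convergence along the filter
   generated by the tails {j | i <= j}. *)
Definition net_filter (J : Type) (le : J -> J -> Prop) : set_system J :=
  filter_from [set: J] (fun i => [set j | le i j]).

Definition card_set (T : choiceType) (S : set T) : nat := #|` fset_set S|%fset.

(* [card_set] is 0 on infinite sets, but it is applied to finite sets only:
   the dilation of a finite set by a finite set is finite. *)
Definition Folner_net (R : realType) (G : groupType) (J : Type)
    (le : J -> J -> Prop) (F : J -> set G) :=
  (forall j, finite_set (F j) /\ F j !=set0) /\
  forall E : set G, finite_set E ->
    ((card_set (dilation (F j) E `\` F j))%:R / (card_set (F j))%:R : R)
      @[j --> net_filter le] --> (0 : R).

Definition amenable (R : realType) (G : groupType) :=
  exists (J : Type) (le : J -> J -> Prop) (F : J -> set G),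
    directed_set le /\ Folner_net R le F.

(* Main.v *)
(* If [tau] misses [y] in [X], compactness of [X] gives a finite [Omega] such
   that no configuration of [tau X] agrees with [y] on [Omega], hence, by
   equivariance, none contains a translate of the pattern [y|Omega]. By
   irreducibility this pattern can be inserted in any configuration at the price
   of changing it on a translate of [Omega^{+Delta}]; so each of the |F| / K
   well separated sites chosen in a Folner set [F] cuts the number of patterns
   avoiding [y|Omega] by a factor (q - 1) / q with [q] independent of [F].
   Conversely, extend the patterns of [X] on H = F Omega by a fixed configuration
   outside [H^{+Delta}]: the resulting configurations are almost equal, so
   pre-injectivity makes their images distinct, and these images are determined
   by their restriction to a set exceeding [H] by o(|F|) sites only. Comparing
   both estimates yields q^t <= |A|^o(t) (q - 1)^t with t >= |F| / K, which is
   absurd. *)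
Require Import Defs.
From mathcomp Require Import all_boot all_algebra monoid finmap zify.
From mathcomp Require Import all_classical all_reals topology normedtype.

Import GRing.Theory Num.Theory numFieldNormedType.Exports.

Local Open Scope classical_set_scope.
Local Open Scope ring_scope.

(** * Compactness of subshifts through ultrafilters *)

Lemma config_cvgP {T : Type} {U : set_system T} {G : groupType} {A : finType}
    (u : T -> config G A) (x : config G A) (FU : Filter U) :
  (u @ U --> x) <-> (forall g, \forall i \near U, u i g = x g).
Proof.
have surj g : range (fun f : config G A => f g) = setT.
  by rewrite eqEsubset; split=> v // _; exists (fun=> v).
rewrite cvg_sup; split=> ux g.
- have := ux g; rewrite cvg_image // => /(_ _ (discrete_set1 (x g))) [B UB Bx].
  have uB : \forall i \near U, B (u i) := UB.
  apply: filterS uB => i Bi.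
  have : [set f g | f in B] (u i g) by exists (u i).
  by rewrite Bx.
- rewrite cvg_image // => W /nbhs_singleton Wx.
  exists [set f : config G A | W (f g)]; last first.
    rewrite eqEsubset; split=> v /=; first by case=> f Wf <-.
    by move=> Wv; exists (fun=> v).
  by apply: filterS (ux g) => i /= ->.
Qed.

(** Compactness of [X]: as [A] is finite, each coordinate is eventually constant along an
    ultrafilter. *)
Lemma ultra_config_limit {T : Type} {U : set_system T} {G : groupType}
    {A : finType} {X : set (config G A)} (UU : UltraFilter U)
    (u : T -> config G A) : closed X -> (\forall i \near U, X (u i)) ->
  exists2 x, X x & forall g, \forall i \near U, u i g = x g.
Proof.
move=> clX uX.
have lim g : exists a : A, \forall i \near U, u i g = a.
  apply: contrapT => /forallNP nlim.
  have : \forall i \near U, forall a : A, u i g <> a.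
    apply: filter_forall => a.
    by have [/nlim|] := in_ultra_setVsetC [set i | u i g = a] UU.
  by move=> /filter_ex [i] /(_ (u i g)).
have [x ux] := choice lim.
exists x => //; apply: (closed_cvg X clX uX).
exact/config_cvgP.
Qed.

(** Limits along this ultrafilter replace limits along an exhausting sequence of finite sets, which
    an uncountable group does not have. *)
Lemma fset_ultrafilter (T : choiceType) : exists2 U : set_system {fset T},
  UltraFilter U & forall t, \forall F \near U, t \in F.
Proof.
pose tails : set_system {fset T} :=
  filter_from [set: {fset T}]
    (fun F : {fset T} => [set F' : {fset T} | {subset F <= F'}]).
have PF : ProperFilter tails.
  apply: filter_from_proper; last by move=> F _; exists F.
  apply: filter_from_filter; first by exists fset0.
  move=> F1 F2 _ _; exists (F1 `|` F2)%fset => // F sF.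
  by split=> t tF; apply: sF; rewrite in_fsetU tF ?orbT.
have [U [UU sU]] := ultraFilterLemma PF.
exists U => // t; apply: sU; exists [fset t]%fset => // F; apply.
exact: fset11.
Qed.

(** Irreducibility handles each finite part of the complement; a limit over growing finite parts
    handles all of it. *)
Lemma irreducible_wrt_compl {G : groupType} {A : finType} {Delta : set G}
    {X : set (config G A)} (clX : closed X) (irrX : irreducible_wrt Delta X)
    {Omega : set G} (finOmega : finite_set Omega) (x1 x2 : config G A) :
  X x1 -> X x2 ->
  exists x, [/\ X x, {in Omega, x =1 x1} &
    {in ~` dilation Omega Delta, x =1 x2}].
Proof.
move=> Xx1 Xx2.
have [U UU Uin] := fset_ultrafilter G.
have /choice[u uP] (F : {fset G}) : exists x, [/\ X x, {in Omega, x =1 x1} &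
    {in [set` F] `\` dilation Omega Delta, x =1 x2}].
  apply: irrX => //; first exact/finite_setD/finite_fset.
  by rewrite setIDA setIC -setIDA setDv setI0.
have [|x Xx ux] := ultra_config_limit UU u clX.
  by apply: nearW => F; case: (uP F).
exists x; split=> // g gO.
  have [F <-] := filter_ex (ux g).
  by case: (uP F) => _ /(_ g gO).
have [F [<- gF]] := filter_ex (filterI (ux g) (Uin g)).
case: (uP F) => _ _; apply.
by move: gO; rewrite !inE => gO; split.
Qed.

(** * Local rule of a cellular automaton and closedness of its image *)

(** Curtis-Hedlund-Lyndon: equivariance reduces to the site 1, where pairs agreeing on ever larger
    finite sets but with different images would contradict continuity at their common limit. *)
Lemma cellular_automaton_memory {G : groupType} {A : finType}
    {X : set (config G A)} {tau : config G A -> config G A} :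
  subshift X -> cellular_automaton X tau ->
  exists M : {fset G}, forall g x1 x2, X x1 -> X x2 ->
    {in M, forall m, x1 (g * m)%g = x2 (g * m)%g} -> tau x1 g = tau x2 g.
Proof.
move=> [clX shX] [_ ctau etau].
suff [M MP] : exists M : {fset G}, forall x1 x2, X x1 -> X x2 ->
    {in M, x1 =1 x2} -> tau x1 1%g = tau x2 1%g.
  exists M => g x1 x2 Xx1 Xx2 x12.
  have tauE x : X x -> tau x g = tau (shift_config g^-1%g x) 1%g.
    by move=> Xx; rewrite etau// /shift_config invgK mulg1.
  rewrite !tauE//; apply: MP; [exact: shX|exact: shX|] => m mM.
  by rewrite /shift_config invgK x12.
apply: contrapT => /forallNP noM.
have /choice[u uP] (F : {fset G}) : exists p : config G A * config G A,
    [/\ X p.1, X p.2, {in F, p.1 =1 p.2} & tau p.1 1%g <> tau p.2 1%g].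
  apply: contrapT => nF; apply: (noM F) => x1 x2 Xx1 Xx2 x12.
  by apply: contrapT => nx; apply: nF; exists (x1, x2).
have [U UU Uin] := fset_ultrafilter G.
have uX1 : \forall F \near U, X (u F).1 by apply: nearW => F; case: (uP F).
have uX2 : \forall F \near U, X (u F).2 by apply: nearW => F; case: (uP F).
have [x Xx ux1] := ultra_config_limit UU (fst \o u) clX uX1.
have ux2 g : \forall F \near U, (u F).2 g = x g.
  apply: filterS (filterI (ux1 g) (Uin g)) => F /= [<- gF].
  by case: (uP F) => _ _ ->.
(* Both halves of [u] converge to [x], so their images agree at [1]. *)
have tau_lim (v : {fset G} -> config G A) : (forall F, X (v F)) ->
    (forall g, \forall F \near U, v F g = x g) ->
    \forall F \near U, tau (v F) 1%g = tau x 1%g.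
  move=> vX vlim; have vx : v @ U --> x by exact/config_cvgP.
  have tx : tau @ within X (nbhs x) --> tau x.
    by move/subspace_continuousP : ctau; apply.
  have : tau \o v @ U --> tau x.
    apply: cvg_trans tx => W; rewrite /fmap /= => /vx /= vW.
    have {}vW : \forall F \near U, X (v F) -> W (tau (v F)) := vW.
    by apply: filterS vW => F; apply; exact: vX.
  by move=> /config_cvgP/(_ 1%g).
have t1 : \forall F \near U, tau (u F).1 1%g = tau x 1%g.
  by apply: (tau_lim (fst \o u)) => // F; case: (uP F).
have t2 : \forall F \near U, tau (u F).2 1%g = tau x 1%g.
  by apply: (tau_lim (snd \o u)) => // F; case: (uP F).
have [F [e1 e2]] := filter_ex (filterI t1 t2).
by case: (uP F) => _ _ _; apply; rewrite e1 e2.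
Qed.

(** Otherwise configurations whose images match [y] on ever larger finite sets would have a limit in
    [X], sent to [y] by locality. *)
Lemma image_avoids_pattern {G : groupType} {A : finType}
    {X : set (config G A)} {tau : config G A -> config G A} {M : {fset G}}
    (y : config G A) :
  closed X ->
  (forall g x1 x2, X x1 -> X x2 ->
    {in M, forall m, x1 (g * m)%g = x2 (g * m)%g} -> tau x1 g = tau x2 g) ->
  ~ (tau @` X) y ->
  exists Omega : {fset G}, forall x, X x -> ~ {in Omega, tau x =1 y}.
Proof.
move=> clX MP ntau; apply: contrapT => /forallNP noO; apply: ntau.
have /choice[u uP] (F : {fset G}) : exists x, X x /\ {in F, tau x =1 y}.
  apply: contrapT => /forallNP nx; apply: (noO F) => x Xx xy.
  exact: (nx x).
have [U UU Uin] := fset_ultrafilter G.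
have [|x Xx ux] := ultra_config_limit UU u clX.
  by apply: nearW => F; case: (uP F).
exists x => //; apply/funext => g.
have near_M : \forall F \near U, forall m : M,
    u F (g * val m)%g = x (g * val m)%g.
  by apply: filter_forall => m; exact: ux.
have [F [uxM gF]] := filter_ex (filterI near_M (Uin g)).
have [XuF <-//] := uP F.
apply: MP => // m mM; exact/esym/(uxM [` mM]%fset).
Qed.

(** * Finite dilations and Folner sets *)

Definition fset_dil {G : groupType} (H K : {fset G}) : {fset G} :=
  [fset (h * k^-1)%g | h in H, k in K]%fset.

Lemma fset_dilP {G : groupType} (H K : {fset G}) (g : G) :
  reflect (exists2 k, k \in K & (g * k)%g \in H) (g \in fset_dil H K).
Proof.
apply: (iffP (imfset2P _ _ _ _ _)) => /= [[h hH [k kK ->]]|[k kK gkH]].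
  by exists k => //; rewrite mulgVK.
by exists (g * k)%g => //; exists k => //; rewrite mulgK.
Qed.

Lemma dilation_fset {G : groupType} (H K : {fset G}) :
  dilation [set` H] [set` K] = [set` fset_dil H K].
Proof.
apply/seteqP; split=> g /=.
  by case=> _ [[k kK <-] gkH]; apply/fset_dilP; exists k.
by move=> /fset_dilP[k kK gkH]; exists (g * k)%g; split=> //; exists k.
Qed.

Lemma amenable_Folner_set {R : realType} {G : groupType} (E : {fset G})
    (n : nat) : amenable R G ->
  exists2 F : {fset G}, F != fset0 &
    (n * #|` (fset_dil F E `\` F)%fset| <= #|` F|)%N.
Proof.
move=> [J [le [F [[[j0] lexx letr led] [finF Fol]]]]].
have PF : ProperFilter (net_filter le).
  apply: filter_from_proper; last by move=> j _; exists j => /=.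
  apply: filter_from_filter; first by exists j0.
  move=> i j _ _; have [k [ik jk]] := led i j; exists k => // l /= kl.
  by split; exact: letr kl.
(* The threshold 1/(n+1), unlike 1/n, is positive also for n = 0. *)
have /cvgr0_norm_lt/(_ (n.+1%:R^-1)) := Fol [set` E] (finite_fset E).
rewrite invr_gt0 ltr0Sn => /(_ erefl) /filter_ex[j].
have [finFj [g Fg]] := finF j.
have FE : F j = [set` fset_set (F j)] by rewrite fset_setK.
set Fj := fset_set (F j) in FE.
have Fj0 : Fj != fset0.
  by apply/fset0Pn; exists g; rewrite in_fset_set// inE.
rewrite FE dilation_fset /card_set fset_setD ?set_fsetK//.
rewrite ger0_norm ?divr_ge0 ?ler0n//.
rewrite ltr_pdivrMr ?ltr0n ?cardfs_gt0// ltr_pdivlMl ?ltr0Sn//.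
rewrite -natrM ltr_nat => /ltnW lt; exists Fj => //.
by apply: leq_trans lt; rewrite leq_mul.
Qed.

(** * Counting patterns *)

Definition restr {G : groupType} {A : finType} (F : {fset G})
  (x : config G A) : {ffun F -> A} := [ffun g : F => x (val g)].

Lemma restrP {G : groupType} {A : finType} (F : {fset G})
    (x1 x2 : config G A) :
  restr F x1 = restr F x2 <-> {in F, x1 =1 x2}.
Proof.
split=> [/ffunP e g gF|e]; last by apply/ffunP => g; rewrite !ffunE e// fsvalP.
by have := e [` gF]%fset; rewrite !ffunE.
Qed.

Definition patterns {G : groupType} {A : finType} (F : {fset G})
  (P : set (config G A)) : {set {ffun F -> A}} :=
  [set u | `[< (restr F @` P) u >]].

Lemma patternsP {G : groupType} {A : finType} (F : {fset G})
    (P : set (config G A)) (u : {ffun F -> A}) :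
  reflect (exists2 x, P x & restr F x = u) (u \in patterns F P).
Proof. by rewrite inE; exact: asboolP. Qed.

Lemma mem_patterns {G : groupType} {A : finType} (F : {fset G})
    (P : set (config G A)) (x : config G A) :
  P x -> restr F x \in patterns F P.
Proof. by move=> Px; apply/patternsP; exists x. Qed.

Lemma patternsS {G : groupType} {A : finType} (F : {fset G})
    (P Q : set (config G A)) :
  P `<=` Q -> patterns F P \subset patterns F Q.
Proof.
move=> PQ; apply/fintype.subsetP => u /patternsP[x /PQ Qx <-].
exact: mem_patterns.
Qed.

(** Choosing a representative in [P] of each pattern turns [f] into an injection from patterns to
    [S]. *)
Lemma card_patterns_le {G : groupType} {A : finType} {F : {fset G}}
    {P : set (config G A)} {T : finType} (f : config G A -> T) (S : {set T}) :
  (forall x, P x -> f x \in S) ->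
  (forall x1 x2, P x1 -> P x2 -> f x1 = f x2 -> {in F, x1 =1 x2}) ->
  (#|patterns F P| <= #|S|)%N.
Proof.
move=> fS finj.
(* Outside the empty case, [x0] is the default value of the choice function [r]. *)
have [->|[_ /patternsP[x0 _ _]]] := set_0Vmem (patterns F P).
  by rewrite cards0.
have /choice[r rP] (u : {ffun F -> A}) : exists x, u \in patterns F P ->
    P x /\ restr F x = u.
  have [/patternsP[x Px xu]|nu] := boolP (u \in patterns F P).
    by exists x.
  by exists x0.
rewrite -(card_in_imset (f := f \o r)).
  apply/subset_leq_card/fintype.subsetP => _ /imsetP[u uP ->] /=.
  by apply: fS; case: (rP u).
move=> u v /rP[Pu ru] /rP[Pv rv] /= e.
by rewrite -ru -rv; apply/restrP; exact: finj.
Qed.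

Lemma card_patterns_extend {G : groupType} {A : finType} (F F' : {fset G})
    (P : set (config G A)) :
  (#|patterns F' P| <= #|patterns F P| * #|A| ^ #|` (F' `\` F)%fset|)%N.
Proof.
pose D := (F' `\` F)%fset.
have -> : (#|patterns F P| * #|A| ^ #|` D|)%N =
    #|finset.setX (patterns F P) [set: {ffun D -> A}]|.
  by rewrite cardsX cardsT card_ffun -cardfE.
apply: (card_patterns_le (fun x => (restr F x, restr D x))) => [x Px|].
  by rewrite inE/= mem_patterns// inE.
move=> x1 x2 _ _ [/restrP e1 /restrP e2] g gF'.
by have [/e1//|gF] := boolP (g \in F); rewrite e2// in_fsetD gF.
Qed.

(** * Configurations avoiding translates of a pattern *)

Definition occurs_at {G : groupType} {A : finType} (Omega : {fset G})
    (y : config G A) (g : G) (x : config G A) :=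
  {in Omega, forall w, x (g * w)%g = y w}.

Definition avoiding {G : groupType} {A : finType} (X : set (config G A))
    (Omega : {fset G}) (y : config G A) (S : {fset G}) : set (config G A) :=
  [set x | X x /\ forall s, s \in S -> ~ occurs_at Omega y s x].

(** Forcing [y] at [g] changes [H] only inside [gE], so |W| <= q |W''|; patterns of W' and W'' are
    disjoint among those of W, so |W'| + |W''| <= |W|. *)
Lemma card_avoiding_fsetU1 {G : groupType} {A : finType}
    {X : set (config G A)} {D Omega H S : {fset G}} {y : config G A} {g : G}
    (q := (#|A| ^ #|` fset_dil Omega D|)%N) :
  subshift X -> irreducible_wrt [set` D] X -> X y ->
  (forall s w, s \in (g |` S)%fset -> w \in Omega -> (s * w)%g \in H) ->
  (forall s w e, s \in S -> w \in Omega -> e \in fset_dil Omega D ->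
    (s * w)%g <> (g * e)%g) ->
  (q * #|patterns H (avoiding X Omega y (g |` S)%fset)| <=
   q.-1 * #|patterns H (avoiding X Omega y S)|)%N.
Proof.
move=> [_ shX] irrX Xy SH Sg.
set W := avoiding X Omega y S; set W' := avoiding X Omega y _.
pose W'' := W `&` [set x | occurs_at Omega y g x].
pose gE := [fset (g * e)%g | e in fset_dil Omega D]%fset.
have A0 : (0 < #|A|)%N by apply/card_gt0P; exists (y 1%g).
have gH w : w \in Omega -> (g * w)%g \in H by move=> wO; rewrite SH// fset1U1.
have le1 : (#|patterns H W| <= #|patterns (H `\` gE)%fset W| * q)%N.
  apply: leq_trans (card_patterns_extend (H `\` gE)%fset H W) _.
  rewrite leq_mul// leq_pexp2l//.
  apply: (@leq_trans #|` gE|); last exact: leq_imfset_card.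
  apply/fsubset_leq_card/fsubsetP => h.
  by rewrite !inE; case: (h \in H); rewrite ?andbF ?andbT ?orbF ?negbK//.
have glue x : exists x', W x ->
    W'' x' /\ {in (H `\` gE)%fset, x' =1 x}.
  have [Wx|nWx] := pselect (W x); last by exists x.
  have [Xx avx] := Wx.
  pose gO := [fset (g * w)%g | w in Omega]%fset.
  have [] := irrX [set` gO] [set` (H `\` gE)%fset] (finite_fset _)
    (finite_fset _) _ (shift_config g y) x (shX g y Xy) Xx.
    rewrite dilation_fset -subset0 => h /= [/fset_dilP[d dD]].
    move=> /imfsetP[w /= wO hd] /=; rewrite in_fsetD => /andP[/negP + _]; apply.
    apply/imfsetP.
    exists (w * d^-1)%g; last by rewrite /= mulgA -hd mulgK.
    by apply/fset_dilP; exists d; rewrite // mulgVK.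
  move=> x' [Xx' x'y x'x].
  exists x' => _; split; last by move=> h hH; apply: x'x; rewrite inE.
  split; last first.
    move=> w wO; rewrite x'y; last by rewrite inE /=; apply/imfsetP; exists w.
    by rewrite /shift_config mulKg.
  (* By the separation hypothesis s Omega misses [gE], so an occurrence at [s] in [x'] would already
     be one in [x]. *)
  split=> // s sS occ; apply: (avx s sS) => w wO.
  rewrite -(occ w wO) x'x// inE /= in_fsetD SH ?fset1Ur// andbT.
  by apply/imfsetP => -[e /= eE]; exact: Sg.
have [f fP] := choice glue.
have le2 : (#|patterns (H `\` gE)%fset W| <= #|patterns H W''|)%N.
  apply: (card_patterns_le (restr H \o f)) => [x /fP[Wf _]|].
    exact: mem_patterns.
  move=> x1 x2 /fP[_ e1] /fP[_ e2] /restrP e h hH.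
  by rewrite -e1// -e2// e//; move: hH; rewrite in_fsetD => /andP[].
have le3 : (#|patterns H W'| + #|patterns H W''| <= #|patterns H W|)%N.
  have dis : finset.setI (patterns H W') (patterns H W'') = finset.set0.
    apply/finset.setP => u; rewrite !finset.inE; apply/negP => /andP[].
    move=> /asboolP[x1 [_ av] <-] /asboolP[x2 [_ occ] /restrP e].
    by apply: (av g); rewrite ?fset1U1// => w wO; rewrite -e ?gH ?occ.
  rewrite -cardsUI dis cards0 addn0; apply/subset_leq_card; rewrite finset.subUset.
  apply/andP; split; apply: patternsS => x; last by case.
  by move=> [Xx av]; split=> // s sS; apply: av; rewrite fset1Ur.
have q0 : (0 < q)%N by rewrite expn_gt0 A0.
have : (#|patterns H W| <= #|patterns H W''| * q)%N.
  by apply: leq_trans le1 _; rewrite leq_mul2r le2 orbT.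
rewrite -(prednK q0); nia.
Qed.

(** Here [t] counts the sites kept; each one removes at most [K] sites, itself included, and
    contributes one factor (q - 1) / q. *)
Lemma card_avoiding_le {G : groupType} {A : finType}
    {X : set (config G A)} {D Omega H : {fset G}} {y : config G A}
    (q := (#|A| ^ #|` fset_dil Omega D|)%N)
    (K := #|` (1%g |` fset_dil (fset_dil Omega D) Omega)%fset|) :
  subshift X -> irreducible_wrt [set` D] X -> X y ->
  forall S : {fset G},
  (forall s w, s \in S -> w \in Omega -> (s * w)%g \in H) ->
  exists2 t, (#|` S| <= K * t)%N &
    (q ^ t * #|patterns H (avoiding X Omega y S)| <=
     q.-1 ^ t * #|patterns H X|)%N.
Proof.
move=> shX irrX Xy S; have [n] := ubnP #|` S|; elim: n S => // n IH S leSn SH.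
(* Greedy choice of the sites: keep [g], discard the sites [s] for which
   s Omega meets g Omega^{+D}. *)
have [->|[g gS]] := fset_0Vmem S.
  exists 0%N; first by rewrite cardfs0.
  rewrite !expn0 !mul1n; apply/subset_leq_card/patternsS => x; by case.
(* The added 1 puts [g] in [B] even if the dilation is empty, so that the induction decreases. *)
pose B := [fset (g * b)%g |
  b in (1%g |` fset_dil (fset_dil Omega D) Omega)%fset]%fset.
have gB : g \in B.
  by apply/imfsetP; exists 1%g; rewrite ?mulg1//= fset1U1.
have SBS : {subset (S `\` B)%fset <= S} by move=> s; rewrite in_fsetD => /andP[].
have [||t tS tle] := IH (S `\` B)%fset.
- rewrite -ltnS; apply: leq_trans leSn; rewrite ltnS; apply: fproper_ltn_card.
  rewrite fproperE fsubsetDl; apply/fsubsetPn; exists g => //.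
  by rewrite in_fsetD gB.
- by move=> s w /SBS; exact: SH.
exists t.+1.
  rewrite mulnS -(cardfsID B S) leq_add//.
  apply: leq_trans (fsubset_leq_card (fsubsetIr _ _)) _.
  exact: leq_imfset_card.
have gSS : {subset (g |` (S `\` B))%fset <= S}.
  by move=> s; rewrite in_fset1U => /orP[/eqP->//|/SBS].
have step : (q * #|patterns H (avoiding X Omega y (g |` (S `\` B))%fset)| <=
   q.-1 * #|patterns H (avoiding X Omega y (S `\` B)%fset)|)%N.
  apply: card_avoiding_fsetU1 => //.
    by move=> s w /gSS; exact: SH.
  move=> s w e; rewrite in_fsetD => /andP[/negP + _] wO eE sw; apply.
  apply/imfsetP; exists (g^-1 * s)%g; last by rewrite /= mulVKg.
  rewrite /= fset1Ur//; apply/fset_dilP; exists w => //.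
  by rewrite -mulgA sw mulKg.
have sub : (#|patterns H (avoiding X Omega y S)| <=
    #|patterns H (avoiding X Omega y (g |` (S `\` B))%fset)|)%N.
  apply/subset_leq_card/patternsS => x [Xx av]; split=> // s /gSS; exact: av.
apply: (@leq_trans
  (q ^ t * (q.-1 * #|patterns H (avoiding X Omega y (S `\` B)%fset)|))).
  rewrite expnSr -mulnA leq_mul2l; apply/orP; right.
  by apply: leq_trans step; rewrite leq_mul2l sub orbT.
by rewrite mulnCA expnS -mulnA leq_mul2l tle orbT.
Qed.

(** * Numerical estimates *)

Lemma exists_expn_ratio (a p : nat) : exists n, (a * p ^ n < p.+1 ^ n)%N.
Proof.
(* Bernoulli's inequality (1 + 1/p)^n >= 1 + n/p with denominators cleared; it says nothing for p =
   0, treated apart. *)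
have bernoulli n : ((p + n) * p ^ n <= p * p.+1 ^ n)%N.
  elim: n => [|n IHn]; first by rewrite !expn0 addn0.
  rewrite !expnS; nia.
exists (a * p).+1%N; have := bernoulli (a * p).+1.
case: p {bernoulli} => [|p]; first by rewrite !muln0 expn1.
set u := (p.+1 ^ _)%N; set v := (p.+2 ^ _)%N => le.
have u0 : (0 < u)%N by rewrite expn_gt0.
nia.
Qed.

Lemma expn_ratio_lt (a p n b t : nat) :
  (a * p ^ n < p.+1 ^ n)%N -> (0 < t)%N -> (n * b <= t)%N ->
  (a ^ b * p ^ t < p.+1 ^ t)%N.
Proof.
move=> lt t0 /subnKC <-; rewrite !expnD mulnA (expnM p) -expnMn.
(* For b = 0 strictness comes from t > 0, otherwise from the b-th power of the hypothesis. *)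
have [->|b0] := posnP b.
  by rewrite muln0 !expn0 !mul1n subn0 ltn_exp2r.
apply: (@leq_ltn_trans ((a * p ^ n) ^ b * p.+1 ^ (t - n * b))).
  rewrite leq_mul//; case: (t - _)%N => // k; by rewrite leq_exp2r.
by rewrite (expnM p.+1) ltn_mul2r expn_gt0 ltn_exp2r.
Qed.

(** * Consequence of pre-injectivity, and conclusion *)

Lemma card_patterns_pre_injective {G : groupType} {A : finType}
    {X : set (config G A)} {tau : config G A -> config G A}
    {D M H : {fset G}} :
  closed X -> irreducible_wrt [set` D] X ->
  (forall g x1 x2, X x1 -> X x2 ->
    {in M, forall m, x1 (g * m)%g = x2 (g * m)%g} -> tau x1 g = tau x2 g) ->
  pre_injective X tau ->
  (#|patterns H X| <= #|patterns (fset_dil (fset_dil H D) M) (tau @` X)|)%N.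
Proof.
move=> clX irrX tauM inj.
have [->|[_ /patternsP[x0 Xx0 _]]] := set_0Vmem (patterns H X).
  by rewrite cards0.
have /choice[f fP] (x : config G A) : exists x', X x ->
    [/\ X x', {in H, x' =1 x} & {in ~` [set` fset_dil H D], x' =1 x0}].
  have [Xx|nXx] := pselect (X x); last by exists x.
  have [x' [Xx' x'x x'x0]] :=
    irreducible_wrt_compl clX irrX (finite_fset H) x x0 Xx Xx0.
  exists x' => _; split=> //; last by rewrite -dilation_fset.
  by move=> h hH; apply: x'x; rewrite inE.
apply: (card_patterns_le (restr (fset_dil (fset_dil H D) M) \o tau \o f))
  => [x /fP[Xf _ _]|].
  by apply: mem_patterns; exists (f x).
move=> x1 x2 /fP[X1 f1 f1'] /fP[X2 f2 f2'] /restrP e h hH.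
rewrite -f1// -f2//; congr (_ h); apply: inj => //.
  exists [set` fset_dil H D]; split; first exact: finite_fset.
  by move=> g gH; rewrite f1' ?f2'.
apply/funext => g.
have [/e//|gM] := boolP (g \in fset_dil (fset_dil H D) M).
(* Here g M misses the dilation of [H] by [D], outside which both extensions equal [x0]. *)
apply: tauM => // m mM.
have gmH : (g * m)%g \in ~` [set` fset_dil H D].
  by rewrite inE => /= gm; move/negP: gM; apply; apply/fset_dilP; exists m.
by rewrite f1' ?f2'.
Qed.

Theorem theorem1p1 (R : realType) (G : groupType) (A : finType)
    (X : set (config G A)) (hG : amenable R G) (hX : subshift X)
    (hirr : strongly_irreducible X) :
  Myhill_property X.
Proof.
move=> tau ca inj y Xy; apply: contrapT => ny.
have [clX shX] := hX.
have [Delta [/finite_fsetP[D ->] irrX]] := hirr.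
have [M tauM] := cellular_automaton_memory hX ca.
have [Omega0 avoid0] := image_avoids_pattern y clX tauM ny.
(* Adding 1 ensures that [H] = F Omega contains [F], as [boundary] requires. *)
pose Omega := (1%g |` Omega0)%fset.
have avoidO x : X x -> ~ {in Omega, tau x =1 y}.
  by move=> Xx e; apply: (avoid0 x Xx) => w wO; apply: e; rewrite fset1Ur.
pose q := (#|A| ^ #|` fset_dil Omega D|)%N.
pose K := #|` (1%g |` fset_dil (fset_dil Omega D) Omega)%fset|.
have A0 : (0 < #|A|)%N by apply/card_gt0P; exists (y 1%g).
have q0 : (0 < q)%N by rewrite expn_gt0 A0.
have K0 : (0 < K)%N.
  by rewrite cardfs_gt0; apply/fset0Pn; exists 1%g; rewrite fset1U1.
have [n ratio] := exists_expn_ratio #|A| q.-1.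
(* E = M D Omega^-1 makes the dilation of [F] by [E] equal to F Omega D^-1 M^-1, which is [H2]. The
   factor n K then gives n K b <= |F| <= K t, hence n b <= t. *)
pose E := [fset (m * e)%g | m in M, e in fset_dil D Omega]%fset.
have [F F0 Fol] := amenable_Folner_set E (n * K) hG.
pose H := [fset (g * w)%g | g in F, w in Omega]%fset.
pose H2 := fset_dil (fset_dil H D) M.
pose b := #|` (fset_dil F E `\` F)%fset|.
have FOH s w : s \in F -> w \in Omega -> (s * w)%g \in H.
  by move=> sF wO; apply/imfset2P; exists s => //; exists w.
have [t Ft cardF] := card_avoiding_le (H := H) hX irrX Xy F FOH.
have bt : (n * b <= t)%N.
  rewrite -(leq_pmul2l K0); apply: leq_trans Ft.
  by rewrite mulnA (mulnC K).
have t0 : (0 < t)%N.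
  rewrite lt0n; apply: contra_neq F0 => t0; apply: cardfs0_eq.
  by move: Ft; rewrite t0 muln0 leqn0 => /eqP.
have boundary : (#|` (H2 `\` H)%fset| <= b)%N.
  apply/fsubset_leq_card/fsubsetP => h; rewrite !in_fsetD => /andP[hH hH2].
  apply/andP; split.
    by apply: contra hH => hF; rewrite -(mulg1 h) FOH ?fset1U1.
  have /fset_dilP[m mM /fset_dilP[d dD /imfset2P[g /= gF [w wO hg]]]] := hH2.
  apply/fset_dilP; exists (m * (d * w^-1))%g.
    apply/imfset2P; exists m => //; exists (d * w^-1)%g => //.
    by apply/fset_dilP; exists w; rewrite ?mulgVK.
  by rewrite !mulgA hg mulgK.
(* By equivariance, [y] occurring at [s] in tau x means that the image of the shift of [x] by s^-1
   matches [y] on [Omega]. *)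
have tau_avoids : tau @` X `<=` avoiding X Omega y F.
  move=> _ [x Xx <-]; split; first by case: ca => /(_ x Xx).
  move=> s sF occ; have [_ _ etau] := ca.
  apply: (avoidO (shift_config s^-1%g x)); first exact: shX.
  by move=> w wO; rewrite etau// /shift_config invgK occ.
have le : (#|patterns H X| <=
    #|patterns H (avoiding X Omega y F)| * #|A| ^ b)%N.
  apply: leq_trans (card_patterns_pre_injective (H := H) clX irrX tauM inj) _.
  apply: leq_trans (card_patterns_extend H _ _) _.
  by rewrite leq_mul ?leq_pexp2l//; apply/subset_leq_card/patternsS.
have N0 : (0 < #|patterns H X|)%N.
  by apply/card_gt0P; exists (restr H y); exact: mem_patterns.
(* With N = |patterns H X| > 0, [le] and [cardF] give q^t N <= |A|^b (q - 1)^t N, against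
   [expn_ratio_lt]. *)
rewrite -/q -(prednK q0) in cardF.
have := expn_ratio_lt _ _ _ _ _ ratio t0 bt.
rewrite ltnNge => /negP; apply.
rewrite -(leq_pmul2r N0); apply: leq_trans (leq_mul (leqnn _) le) _.
by rewrite mulnA mulnC -mulnA leq_mul// mulnA.
Qed.
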